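(* Let $f,p\in(0,1)$ with $f+p<1$, let $\delta,\zeta\ge 0$ be integers, let $T>0$ and $d\ge 0$ be real numbers, and let $k_d=\left\lfloor\frac{d/T+\delta}{\delta+\zeta+1}\right\rfloor$. Assume $f+\left(\frac{p}{1-f}\right)^{\delta+\zeta}-1\neq 0$. Consider the persistent ARQ system with arrival probability $f$, packet error rate $p$, decoding delay $\zeta$, feedback delay $\delta$ and slot duration $T$ described in the context, in steady state, and let $D$ be the total delay, in slots, of an arriving packet. Then the delay violation probability for the delay target $d$, that is, the probability that the total delay $D\,T$ exceeds $d$, satisfies $$\mathbb{P}(D\,T>d)\;\le\; p^{k_d}+\frac{f\left(\frac{p}{1-f}\right)^{\lfloor d/T\rfloor+\delta}\left(1-p^{k_d}\left(\frac{p}{1-f}\right)^{-k_d(1+\delta+\zeta)}\right)}{f+\left(\frac{p}{1-f}\right)^{\delta+\zeta}-1}.$$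
   Context: Persistent ARQ system. Time is divided into slots $k\in\mathbb{Z}$ of duration $T$. Put $R=1+\zeta+\delta$ (round-trip time in slots). Immediately after the beginning of each slot a new packet arrives with probability $f$, independently over slots. At most one packet is transmitted per slot, and each transmission occupies the whole slot. Each transmission attempt fails with probability $p$, independently over all packets and attempts and independently of the arrivals. A packet whose transmission in slot $k$ fails is retransmitted in slot $k+R$ (after decoding delay $\zeta$ and feedback delay $\delta$). Packets transmitted in the meantime do not wait for this feedback. Retransmissions have priority over first transmissions. New packets wait in an infinite first-in-first-out queue. In each slot in which no retransmission is due, the head of this queue, if the queue is nonempty (a packet arriving in that slot included), is transmitted for the first time. The number of retransmissions is unlimited. Steady state means the stationary regime of the Markov chain, observed at slot boundaries before arrivals, whose state consists of the number of waiting not-yet-transmitted packets and the indicators of whether a retransmission is due in each of the slots $k,k+1,\dots,k+R-1$. Delays of a packet, measured in slots. The wait delay $D_{\mathrm w}$ is the number of slots from the packet's arrival slot to the slot of its first transmission ($D_{\mathrm w}=0$ if it is transmitted in its arrival slot). If the packet is successful at its $m$-th attempt, its service delay is $D_{\mathrm s}=m+m\zeta+(m-1)\delta$ (the feedback of the successful attempt is not counted). The total delay is $D=D_{\mathrm w}+D_{\mathrm s}$. *)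

(* Defs.v *)
From HB Require Import structures.
From mathcomp Require Import all_boot all_order all_algebra.
From mathcomp Require Import all_classical all_reals all_analysis.

Set Implicit Arguments.
Unset Strict Implicit.
Unset Printing Implicit Defensive.

Import Order.TTheory GRing.Theory Num.Theory.

Local Open Scope classical_set_scope.
Local Open Scope ring_scope.

Section Independence.
Context (d : measure_display) (Omega : measurableType d) (R : realType).
Variable P : probability Omega R.

Definition mutually_independent (I : eqType) (F : I -> set (set Omega)) : Prop :=
  forall (J : seq I) (B : I -> set Omega), uniq J ->
    (forall i, i \in J -> F i (B i)) ->
    P (\bigcap_(i in [set` J]) B i) = (\prod_(i <- J) fine (P (B i)))%:E.

Definition sigma_of (d' : measure_display) (T : measurableType d')
    (X : Omega -> T) : set (set Omega) :=
  preimage_set_system setT X measurable.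

Definition cond_prob (B C : set Omega) : R := fine (P (B `&` C)) / fine (P C).

End Independence.

Definition least (p : pred nat) : option nat :=
  if pselect (exists n, p n) is left h then Some (ex_minn h) else None.

Definition delay_of (R : realType) (o : option nat) : \bar R :=
  if o is Some n then (n%:R)%:E else +oo%E.

(* State at the boundary of slot k, before the arrival of slot k: the number of
   waiting packets not yet transmitted, and the tuple whose i-th entry tells
   whether a retransmission is due in slot k + i, for 0 <= i < 1 + zeta + delta. *)
Definition arq_state (zeta delta : nat) : Type :=
  (nat * (1 + zeta + delta).-tuple bool)%type.

Section Dynamics.
Variables zeta delta : nat.

Definition waiting (x : arq_state zeta delta) : nat := x.1.

Definition retx_due (x : arq_state zeta delta) : bool := nth false x.2 0.

(* a: a packet arrives in the slot; e: the transmission made in the slot, if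
   any, fails. A failure in slot k makes a retransmission due in slot
   k + (1 + zeta + delta), the last entry of the tuple seen from slot k + 1. *)
Definition arq_step (x : arq_state zeta delta) (a e : bool) :
    arq_state zeta delta :=
  let q := (waiting x + a)%N in
  let sent := retx_due x || (0 < q)%N in
  ((if retx_due x then q else q.-1),
   [tuple of rcons (behead x.2) (sent && e)]).

End Dynamics.

(* Slots are indexed by int. At most one transmission takes place per slot, so
   the outcome of an attempt is attached to the slot in which it is made:
   E k w = true means that a transmission made in slot k fails; the value is
   irrelevant if nothing is sent in slot k. Independence of X k from all arrivals
   and outcomes in slots >= k makes X a homogeneous Markov chain, so that
   invariance of its one-slot law is stationarity. *)
Record steady_arq (R : realType) (d : measure_display)
    (Omega : measurableType d) (P : probability Omega R)
    (f p : R) (zeta delta : nat)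
    (A E : int -> {RV P >-> bool})
    (X : int -> {RV P >-> arq_state zeta delta}) : Prop := SteadyArq {
  arq_arrival : forall k, P [set w | A k w] = f%:E ;
  arq_failure : forall k, P [set w | E k w] = p%:E ;
  arq_independence : forall k : int,
    mutually_independent P (fun i : unit + (nat + nat) =>
      match i with
      | inl _ => sigma_of (X k)
      | inr (inl n) => sigma_of (A (k + n%:Z))
      | inr (inr n) => sigma_of (E (k + n%:Z))
      end) ;
  arq_evolution : forall k w, X (k + 1) w = arq_step (X k w) (A k w) (E k w) ;
  arq_stationary : forall (k l : int) (x : arq_state zeta delta),
    P (X k @^-1` [set x]) = P (X l @^-1` [set x])
}.

(* Delays of the packet arriving in slot k (meaningful where a packet arrives in
   slot k), along a trajectory x of the state and e of the failures. *)
Section Delays.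
Variables (R : realType) (zeta delta : nat).
Variables (x : int -> arq_state zeta delta) (e : int -> bool) (k : int).

(* Number of packets preceding the packet in the FIFO queue in slot k + n, as
   long as the packet is still waiting. *)
Fixpoint ahead (n : nat) : nat :=
  if n is n'.+1 then
    if retx_due (x (k + n'%:Z)) then ahead n' else (ahead n').-1
  else waiting (x k).

Definition wait : option nat :=
  least (fun n => ~~ retx_due (x (k + n%:Z)) && (ahead n == 0%N)).

(* The i-th attempt, i >= 1, takes place (i - 1) * (1 + zeta + delta) slots after
   the first one. *)
Definition attempts : option nat :=
  if wait is Some n then
    least (fun m => (0 < m)%N &&
             ~~ e (k + (n + (m - 1) * (1 + zeta + delta))%:Z))
  else None.

Definition wait_delay : \bar R := delay_of R wait.

Definition service_delay : \bar R :=
  delay_of R (omap (fun m => m + m * zeta + (m - 1) * delta)%N attempts).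

Definition total_delay : \bar R := (wait_delay + service_delay)%E.

End Delays.

(* Main.v *)
(** The packet waits at least n slots iff at most q of its first n slots are
    free of retransmissions, q being the number of packets ahead of it, and while
    it waits every slot is used; so u(n) = P(D_w >= n) is the stationary mean of
    an explicit function "clear" of the state.  Put v(n) for the same
    probability with one more packet ahead.  Invariance over one slot gives
      u(n) = (1-f) u(n+1) + f v(n+1) + (1-f) b(n),
    b(n) accounting for the slots left idle.  Looking back at the slot that
    produced the last flag involved, v(n+1) <= p v(n) + (1-p) u(n) and
    b(n+1) <= p b(n).  Hence p u(n) - (1-f) u(n+1) is nonincreasing in n; as u
    tends to 0, it is nonnegative, i.e. u(n+1) <= r u(n) with r = p/(1-f).
    Flow conservation gives u(1) <= r f/(1-p), so u(n) <= f/(1-p) r^n for n >= 1.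
    The attempts of the packet are independent of its wait, and summing over the
    number of attempts yields a geometric sum, which is the stated bound. *)

Require Import Defs.
From HB Require Import structures.
From mathcomp Require Import all_boot all_order all_algebra.
From mathcomp Require Import all_classical all_reals all_analysis.
From mathcomp Require Import measurable_realfun.
From mathcomp Require Import ring lra zify.
Import Order.TTheory GRing.Theory Num.Theory.
Import numFieldNormedType.Exports.
Local Open Scope classical_set_scope.
Local Open Scope ring_scope.

Set Implicit Arguments.
Unset Strict Implicit.
Unset Printing Implicit Defensive.

(** * Waiting with saturated service *)

(* [arq_step] on untyped flag lists. *)
Definition lstep (x : nat * seq bool) (a e : bool) : nat * seq bool :=
  let q := (x.1 + a)%N in
  ((if head false x.2 then q else q.-1),
   rcons (behead x.2) ((head false x.2 || (0 < q)%N) && e)).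

Section Clear.
Variables (R : realFieldType) (p : R).
Hypotheses (p_ge0 : 0 <= p) (p_le1 : p <= 1).

(* The probability that fewer than Q of the next n slots are free of
   retransmissions, if l lists the retransmissions already due and every slot
   beyond carries one with probability p. *)
Fixpoint clear (n Q : nat) (l : seq bool) : R :=
  match n, l with
  | 0%N, _ => (0 < Q)%N%:R
  | n'.+1, b :: l' => clear n' (if b then Q else Q.-1) l'
  | n'.+1, [::] => p * clear n' Q [::] + (1 - p) * clear n' Q.-1 [::]
  end.

Lemma clearQ0 n l : clear n 0 l = 0.
Proof.
elim: n l => [|n IHn] [|b l] //=; first by rewrite !IHn !mulr0 addr0.
by rewrite if_same IHn.
Qed.

Lemma clear_homo n Q Q' l : (Q <= Q')%N -> clear n Q l <= clear n Q' l.
Proof.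
elim: n Q Q' l => [|n IHn] Q Q' [|b l] leQ /=.
- by rewrite ler_nat; lia.
- by rewrite ler_nat; lia.
- by apply: lerD; apply: ler_wpM2l; rewrite ?subr_ge0 //; apply: IHn; lia.
- by apply: IHn; case: b; lia.
Qed.

Lemma clear_ge0 n Q l : 0 <= clear n Q l.
Proof. by rewrite -(clearQ0 n l) clear_homo. Qed.

Lemma clear_le1 n Q l : clear n Q l <= 1.
Proof.
elim: n Q l => [|n IHn] Q [|b l] //=; rewrite ?lern1 ?leq_b1 //.
have := lerD (ler_wpM2l p_ge0 (IHn Q [::]))
  (ler_wpM2l (etrans (subr_ge0 _ _) p_le1) (IHn Q.-1 [::])).
by rewrite !mulr1 subrKC.
Qed.

(** The first slot beyond [l] is flagged with probability [p] anyway, so revealing that flag and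
    averaging over it changes nothing. *)
Lemma clear_avg n Q l :
  clear n Q l = p * clear n Q (rcons l true) + (1 - p) * clear n Q (rcons l false).
Proof. by elim: l n Q => [|b l IHl] [|n] Q //=; rewrite ?if_same; ring. Qed.

Lemma clear_cons n Q b l :
  clear n.+1 Q (b :: l) = clear n (if b then Q else Q.-1) l.
Proof. by []. Qed.

(** The recursion peels off the first slot; here the last one is peeled off, which lies beyond [l].
    Only the number of free slots counts, not their order. *)
Lemma clear_last n Q l : (size l <= n)%N ->
  clear n.+1 Q l = p * clear n Q l + (1 - p) * clear n Q.-1 l.
Proof.
elim: l n Q => [|b l IHl] [|n] Q // lt_ln.
by rewrite clear_cons IHl //; case: (b).
Qed.

(** Entry [n] is the last one read: its effect on the threshold can be charged in advance, and what
    follows it is arbitrary. *)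
Lemma clear_cat n Q l0 b l1 l2 : size l0 = n ->
  clear n.+1 Q (l0 ++ b :: l1) = clear n (if b then Q else Q.-1) (l0 ++ l2).
Proof.
elim: l0 n Q => [|c l0 IHl] [|n] Q // [sz].
by rewrite !cat_cons !clear_cons IHl //; case: (b); case: (c).
Qed.

Lemma clear_false n l0 l1 : (size l0 < n)%N -> clear n 1 (l0 ++ false :: l1) = 0.
Proof.
elim: l0 n => [|c l0 IHl] [|n] //= lt_ln; first by rewrite clearQ0.
by case: c; [rewrite IHl | rewrite clearQ0].
Qed.

End Clear.

Arguments clear {R} p n Q l : simpl nomatch.

(** * Stationary means of the one-slot chain, for an abstract expectation *)

Section Stationary.
Variables (R : realType) (f p : R) (N : nat).
Hypotheses (f_gt0 : 0 < f) (f_lt1 : f < 1) (p_gt0 : 0 < p) (p_lt1 : p < 1)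
  (fp_lt1 : f + p < 1).

Notation state := (nat * seq bool)%type.

Definition onestep (h : state -> R) (x : state) : R :=
  f * (p * h (lstep x true true) + (1 - p) * h (lstep x true false)) +
  (1 - f) * (p * h (lstep x false true) + (1 - p) * h (lstep x false false)).

Definition bnd (h : state -> R) : Prop := exists C, forall x, `|h x| <= C.

(** [L] stands for the stationary expectation on bounded functions, known only through the
    properties listed below; measures enter later. *)
Variable L : (state -> R) -> R.
Hypothesis L_lin : forall (a b : R) g h, bnd g -> bnd h ->
  L (fun x => a * g x + b * h x) = a * L g + b * L h.
Hypothesis L_le : forall g h, bnd g -> bnd h ->
  (forall x, size x.2 = N.+1 -> g x <= h x) -> L g <= L h.
Hypothesis L_1 : L (fun=> 1) = 1.
Hypothesis L_onestep : forall h, bnd h -> L (onestep h) = L h.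
Hypothesis L_tail :
  (fun m => L (fun x => (m <= x.1)%N%:R)) @ \oo --> (0 : R).

Lemma bnd_cst c : bnd (fun=> c).
Proof. by exists `|c|. Qed.

Lemma bndD g h : bnd g -> bnd h -> bnd (fun x => g x + h x).
Proof.
move=> [C1 h1] [C2 h2]; exists (C1 + C2) => x.
by rewrite (le_trans (ler_normD _ _)) // lerD.
Qed.

Lemma bndM g h : bnd g -> bnd h -> bnd (fun x => g x * h x).
Proof.
move=> [C1 h1] [C2 h2]; exists (C1 * C2) => x.
by rewrite normrM ler_pM.
Qed.

Lemma bnd_bool (b : state -> bool) : bnd (fun x => (b x)%:R).
Proof. by exists 1 => x; case: (b x); rewrite ?normr1 ?normr0. Qed.

Lemma bnd_comp h (s : state -> state) : bnd h -> bnd (h \o s).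
Proof. by move=> [C hC]; exists C => x /=. Qed.

Lemma bnd_clear n (s : state -> nat) (t : state -> seq bool) :
  bnd (fun x => clear p n (s x) (t x)).
Proof.
exists 1 => x; have p1 := ltW p_lt1; have p0 := ltW p_gt0.
by rewrite ger0_norm ?clear_ge0 ?clear_le1.
Qed.

Lemma bnd_onestep h : bnd h -> bnd (onestep h).
Proof.
move=> bh; rewrite /onestep.
have bs a e : bnd (fun x => h (lstep x a e)) := bnd_comp (lstep^~ a ^~ e) bh.
by do !(apply: bndD || apply: bndM || exact: bnd_cst || exact: bs).
Qed.

Lemma bnd_iter t h : bnd h -> bnd (iter t onestep h).
Proof. by move=> bh; elim: t => //= t; apply: bnd_onestep. Qed.

Hint Resolve bnd_cst bndD bndM bnd_bool bnd_clear bnd_onestep bnd_iter : core.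

Lemma L_eq g h : bnd g -> bnd h ->
  (forall x, size x.2 = N.+1 -> g x = h x) -> L g = L h.
Proof.
by move=> bg bh gh; apply/eqP; rewrite eq_le !L_le // => x /gh ->.
Qed.

Lemma L_scale a g : bnd g -> L (fun x => a * g x) = a * L g.
Proof.
move=> bg; rewrite -[RHS]addr0 -[X in _ + X](mul0r (L g)) -L_lin //.
by congr L; apply/funext => x; rewrite mul0r addr0.
Qed.

Lemma L_0 : L (fun=> 0) = 0.
Proof.
rewrite -[RHS](mul0r (L (fun=> 1))) -L_scale //.
by congr L; apply/funext => x; rewrite mul0r.
Qed.

Lemma L_ge0 g : bnd g -> (forall x, 0 <= g x) -> 0 <= L g.
Proof. by move=> bg g0; rewrite -L_0; apply: L_le. Qed.

Lemma L_lin3 a b c g h k : bnd g -> bnd h -> bnd k ->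
  L (fun x => a * g x + (b * h x + c * k x)) = a * L g + b * L h + c * L k.
Proof.
move=> bg bh bk; rewrite -addrA -L_lin //.
have -> : (fun x => a * g x + (b * h x + c * k x)) =
  (fun x => a * g x + 1 * (fun x => b * h x + c * k x) x).
  by apply/funext => x; rewrite mul1r.
by rewrite L_lin ?mul1r //; auto.
Qed.

Lemma L_iter t h : bnd h -> L (iter t onestep h) = L h.
Proof. by move=> bh; elim: t => //= t IH; rewrite L_onestep ?IH //; auto. Qed.

Lemma onestep_le g h x : (forall a e, g (lstep x a e) <= h (lstep x a e)) ->
  onestep g x <= onestep h x.
Proof.
have ? := ltW p_gt0; have ? := ltW f_gt0.
move=> gh; apply: lerD; apply: ler_wpM2l; rewrite ?subr_ge0 ?(ltW f_lt1) //;
  by apply: lerD; apply: ler_wpM2l; rewrite ?subr_ge0 ?(ltW p_lt1).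
Qed.

Lemma iter_onestep_le t g h : (forall x, g x <= h x) ->
  forall x, iter t onestep g x <= iter t onestep h x.
Proof. by move=> gh; elim: t => //= t IH x; apply: onestep_le. Qed.

(* A function that reads a flag at position n can be traced back to the slot in
   which that flag was produced; the failure of that slot is independent of
   everything else that the function reads. *)
Section Lookback.
Variables (n : nat) (g g0 g1 : state -> R).
Hypothesis gE : forall q l0 (b : bool) l1 l2, size l0 = n ->
  g (q, l0 ++ b :: l1) = (if b then g1 else g0) (q, l0 ++ l2).

(** Each slot drops the head and appends at the end, so in [t] slots the traced flag moves from
    position [n + t] to [n], and what stands behind it is never read. *)
Lemma lookback_iter t q l0 (b : bool) l1 l2 : size l0 = (n + t)%N ->
  iter t onestep g (q, l0 ++ b :: l1) =
  iter t onestep (if b then g1 else g0) (q, l0 ++ l2).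
Proof.
elim: t q l0 b l1 l2 => [|t IHt] q [|c l0] b l1 l2 /= sz; try lia.
- by apply: (@gE q [::]); rewrite -(addn0 n).
- by apply: (@gE q (c :: l0)); rewrite -(addn0 n).
- rewrite /onestep /lstep /= !rcons_cat /=.
  by congr (_ * (_ * _ + _ * _) + _ * (_ * _ + _ * _)); apply: IHt; lia.
Qed.

Hypotheses (bg : bnd g) (bg0 : bnd g0) (bg1 : bnd g1).
Hypothesis g01 : forall x, g0 x <= g1 x.

(** The flag at position [n] was appended [t.+1] slots ago. It is set only if something was sent and
    failed; idle slots, which set no flag, turn the identity into an inequality through
    [g0 <= g1]. *)
Lemma lookback : (n <= N)%N -> L g <= p * L g1 + (1 - p) * L g0.
Proof.
move=> le_nN; set t := (N - n)%N.
rewrite -(L_iter t.+1 bg) -(L_iter t.+1 bg0) -(L_iter t.+1 bg1) -L_lin //; auto.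
apply: L_le; auto => -[q [|c l]] //= [sz].
have szl : size l = (n + t)%N by rewrite /t; lia.
(* A dummy flag [b] inserted after [l] shows that the iterates of [g0] and [g1] do not depend on
   what stands behind [l]. *)
have lb (b : bool) q' l1 l2 : iter t onestep (if b then g1 else g0) (q', l ++ l1)
    = iter t onestep (if b then g1 else g0) (q', l ++ l2).
  by rewrite -(@lookback_iter t q' l b [::] l1) // -(@lookback_iter t q' l b [::] l2).
have lbE q' s : iter t onestep g (q', rcons l s) =
    iter t onestep (if s then g1 else g0) (q', l).
  by rewrite -cats1 (@lookback_iter t q' l s [::] [::]) // cats0.
have lb1 q' s : iter t onestep g1 (q', rcons l s) = iter t onestep g1 (q', l).
  by rewrite -cats1 (lb true q' [:: s] [::]) cats0.
have lb0 q' s : iter t onestep g0 (q', rcons l s) = iter t onestep g0 (q', l).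
  by rewrite -cats1 (lb false q' [:: s] [::]) cats0.
rewrite /onestep /lstep /= !lbE !lb1 !lb0 !andbT !andbF.
have le01 q' : iter t onestep g0 (q', l) <= iter t onestep g1 (q', l).
  exact: iter_onestep_le.
set qa := if c then _ else _; set qb := if c then (q + false)%N else _.
have ha := le01 qa; have hb := le01 qb.
have la (s : bool) q' : iter t onestep (if s then g1 else g0) (q', l) <=
    iter t onestep g1 (q', l) by case: s.
have := la (c || (0 < q + true)%N) qa; have := la (c || (0 < q + false)%N) qb.
move: (iter t onestep (if c || (0 < q + true)%N then g1 else g0) (qa, l)) => y1.
move: (iter t onestep (if c || (0 < q + false)%N then g1 else g0) (qb, l)) => y2.
move=> h2 h1.
move: (iter t onestep g0 (qa, l)) (iter t onestep g1 (qa, l))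
  (iter t onestep g0 (qb, l)) (iter t onestep g1 (qb, l)) h1 h2 ha hb
  => a0 a1 b0 b1 h1 h2 ha hb.
(* The gap is a nonnegative combination of [a1 - y1] and [b1 - y2], which vanish when the slot is
   used. *)
rewrite -subr_ge0.
have -> : p * (f * (p * a1 + (1 - p) * a1) + (1 - f) * (p * b1 + (1 - p) * b1)) +
  (1 - p) * (f * (p * a0 + (1 - p) * a0) + (1 - f) * (p * b0 + (1 - p) * b0)) -
  (f * (p * y1 + (1 - p) * a0) + (1 - f) * (p * y2 + (1 - p) * b0)) =
  p * (f * (a1 - y1) + (1 - f) * (b1 - y2)) by ring.
have f1 := ltW f_lt1; have f0 := ltW f_gt0.
by rewrite mulr_ge0 ?(ltW p_gt0) // addr_ge0 // mulr_ge0 // subr_ge0.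
Qed.

End Lookback.

(** * Recurrences for the tail of the wait and its geometric decay *)

Let u n := L (fun x => clear p n x.1.+1 x.2).
Let v n := L (fun x => clear p n x.1.+2 x.2).
Let idle (x : state) := (x.1 == 0)%N && ~~ head false x.2.
Let b n := L (fun x => (idle x)%:R * clear p n 1 (rcons (behead x.2) false)).

(** If the slot is used, [clear_avg] averages out its failure flag and the slot becomes the first of
    [n.+1]; an arrival raises the threshold by one. If it stays idle, the appended flag is surely
    [false] while [clear] over [n.+1] slots vanishes: hence the term in [b]. *)
Lemma clear_balance n :
  u n = (1 - f) * u n.+1 + f * v n.+1 + (1 - f) * b n.
Proof.
rewrite /u -(L_onestep (bnd_clear n (fun x => x.1.+1) snd)) -L_lin3; auto.
apply: L_eq; auto => -[q [|c l]] //= _.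
rewrite /onestep /lstep /idle /=.
have E Q := clear_avg p n Q l.
case: c => /=; first by rewrite addn0 addn1 (E q.+1) (E q.+2) andbF mul0r; ring.
case: q => [|q] /=; last by rewrite addn0 addn1 /= (E q.+1) (E q.+2) mul0r; ring.
by rewrite clearQ0 (E 1%N) mul1r; ring.
Qed.

(** For [n <= N] the last flag read comes from a past slot and [lookback] applies; for larger [n] it
    is fresh and [clear_last] gives equality. *)
Lemma v_step n : v n.+1 <= p * v n + (1 - p) * u n.
Proof.
case: (leqP n N) => [le_nN|lt_Nn].
- apply: (@lookback n _ (fun x => clear p n x.1.+1 x.2)
     (fun x => clear p n x.1.+2 x.2)); auto.
  + move=> q l0 c l1 l2 sz /=.
    by rewrite (clear_cat _ _ _ _ l2 sz); case: c.
  + by move=> x; rewrite clear_homo ?(ltW p_gt0) ?(ltW p_lt1).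
- rewrite -L_lin; auto; apply: L_le; auto => x sz.
  by rewrite clear_last ?sz.
Qed.

Lemma b_step n : b n.+1 <= p * b n.
Proof.
have p0 := ltW p_gt0; have p1 := ltW p_lt1.
have b_ge0 m : 0 <= b m.
  by apply: L_ge0; auto => x; rewrite mulr_ge0 ?clear_ge0.
case: (ltnP n N) => [lt_nN|le_Nn].
- rewrite -[leRHS]addr0 -(mulr0 (1 - p)) -L_0.
  (* The list read lacks the head of the state, so the traced flag sits at position [n.+1]; if it is
     [false] it exhausts the threshold one, whence the zero function. *)
  apply: (@lookback n.+1 _ (fun=> 0)
     (fun x => (idle x)%:R * clear p n 1 (rcons (behead x.2) false))); auto;
     last by move=> x; rewrite mulr_ge0 ?clear_ge0.
  move=> q [|c0 l0] c l1 l2 //= [sz]; rewrite /idle /= !rcons_cat /=.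
  rewrite (clear_cat _ _ _ _ (rcons l2 false) sz).
  by case: c => /=; rewrite ?rcons_cat // clearQ0 mulr0.
- have -> : b n.+1 = L (fun=> 0).
    apply: L_eq; auto => x sz; rewrite -cats1 clear_false ?mulr0 //.
    by rewrite size_behead sz /=; lia.
  by rewrite L_0 mulr_ge0.
Qed.

(** Put y(n) = f v(n+1) + (1-f) b(n), which is u(n) - (1-f) u(n+1) by the balance. Then y(n+1) <= p
    y(n) + f (1-p) u(n+1), and substituting for y gives the claim. *)
Lemma defect_step n :
  p * u n.+1 - (1 - f) * u n.+2 <= p * u n - (1 - f) * u n.+1.
Proof.
have := clear_balance n; have := clear_balance n.+1.
have := v_step n.+1; have := b_step n.
move: (u n) (u n.+1) (u n.+2) (v n.+1) (v n.+2) (b n) (b n.+1).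
move=> u0 u1 u2 v1 v2 b0 b1 hb hv e1 e0.
have h1 : f * v2 <= f * (p * v1 + (1 - p) * u1) by rewrite ler_pM2l.
have h2 : (1 - f) * b1 <= (1 - f) * (p * b0) by rewrite ler_pM2l ?subr_gt0.
nra.
Qed.

(* Lowering the threshold by m; the limits of w m and w m.+1 coincide, so that
   the limit of u is at most the stationary probability of m waiting packets. *)
Let w m n := L (fun x => clear p n (x.1.+1 - m) x.2).

Lemma w_step m n : (N < n)%N -> w m n.+1 = p * w m n + (1 - p) * w m.+1 n.
Proof.
move=> lt_Nn; rewrite -L_lin; auto; apply: L_eq; auto => x sz.
by rewrite clear_last ?sz // subnS.
Qed.

Lemma w_ge0 m n : 0 <= w m n.
Proof.
by apply: L_ge0; auto => x; rewrite clear_ge0 ?(ltW p_gt0) ?(ltW p_lt1).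
Qed.

Lemma w_cvg m : cvgn (w m).
Proof.
suff : cvgn (fun n => w m (n + N.+1)).
  by move=> /cvg_ex[l wl]; apply/cvg_ex; exists l; rewrite -(cvg_shiftn N.+1).
apply: nonincreasing_is_cvgn; last by exists 0 => _ [n _ <-]; apply: w_ge0.
apply/nonincreasing_seqP => n /=; rewrite addSn w_step; last by lia.
have : w m.+1 (n + N.+1)%N <= w m (n + N.+1)%N.
  apply: L_le; auto => x _.
  by rewrite clear_homo ?(ltW p_gt0) ?(ltW p_lt1) //; lia.
by have := p_lt1; nra.
Qed.

Lemma u_cvg0 : u @ \oo --> (0 : R).
Proof.
have lim_w m : limn (w m) = limn (w m.+1).
  have h1 : (fun n => w m (n + N.+1).+1) @ \oo --> limn (w m).
    have := @w_cvg m; rewrite -(cvg_shiftn N.+2).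
    by under [X in X @ \oo --> _ -> _]eq_fun do rewrite addnS.
  have h2 : (fun n => p * w m (n + N.+1) + (1 - p) * w m.+1 (n + N.+1)) @ \oo -->
      p * limn (w m) + (1 - p) * limn (w m.+1).
    apply: cvgD; apply: cvgMr.
      by rewrite (cvg_shiftn N.+1 (w m)); exact: @w_cvg.
    by rewrite (cvg_shiftn N.+1 (w m.+1)); exact: @w_cvg.
  (* The limit of [w_step]; cancelling 1 - p identifies the two limits. *)
  have : limn (w m) = p * limn (w m) + (1 - p) * limn (w m.+1).
    apply: (cvg_unique _ h1); first exact: norm_hausdorff.
    apply: cvg_trans h2; apply: near_eq_cvg; near=> n.
    by rewrite w_step //; lia.
  have : 1 - p != 0 by rewrite subr_eq0 gt_eqF.
  move=> /mulfI q_inj /eqP; rewrite -subr_eq0 => /eqP e; apply: q_inj.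
  by apply/eqP; rewrite -subr_eq0 -e; apply/eqP; ring.
have lim_0 m : limn (w 0) = limn (w m) by elim: m => // m ->.
have lim_le m : limn (w 0) <= L (fun x => (m <= x.1)%N%:R).
  rewrite (lim_0 m); apply: limr_le; first exact: @w_cvg.
  near=> n; apply: L_le; auto => x _.
  case: leqP => [le_mx|lt_xm].
    by rewrite clear_le1 ?(ltW p_gt0) ?(ltW p_lt1).
  by have -> : (x.1.+1 - m)%N = 0%N; [lia | rewrite clearQ0].
have : limn (w 0) <= 0.
  by rewrite -(cvg_lim _ L_tail) //; apply: limr_ge; [apply/cvg_ex; exists 0 |
    near=> n].
have -> : u = w 0 by apply/funext => n; rewrite /u /w; under [in RHS]eq_fun do rewrite subn0.
have : 0 <= limn (w 0).
  by apply: limr_ge; [exact: @w_cvg | near=> n; exact: w_ge0].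
by move=> l0 l1; have <- : limn (w 0) = 0; [lra | exact: @w_cvg].
Unshelve. all: by end_near. Qed.

Lemma u_decay n : (1 - f) * u n.+1 <= p * u n.
Proof.
rewrite -subr_ge0.
have defect k : p * u (k + n)%N - (1 - f) * u (k + n).+1 <= p * u n - (1 - f) * u n.+1.
  by elim: k => // k IH; rewrite addSn (le_trans (defect_step _)).
have h : (fun k => p * u (k + n)%N - (1 - f) * u (k + n).+1) @ \oo --> p * 0 - (1 - f) * 0.
  apply: cvgB; apply: cvgMr.
    by rewrite (cvg_shiftn n u); exact: u_cvg0.
  have := u_cvg0; rewrite -(cvg_shiftn n.+1).
  by under [X in X @ \oo --> _ -> _]eq_fun do rewrite addnS.
have -> : 0 = p * 0 - (1 - f) * 0 :> R by rewrite !mulr0 subrr.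
rewrite -(cvg_lim _ h) //; apply: limr_le; first by apply/cvg_ex; eexists; exact: h.
by near=> k; exact: defect.
Unshelve. all: by end_near. Qed.

(** * Flow conservation and the probability of waiting at least one slot *)

Let due := L (fun x => (head false x.2)%:R).

(** Flags move forward one place per slot, so all have the same mean. The last one is set if the
    slot just past was used and failed, and [u 1] is the probability that a retransmission is due or
    a packet waits. *)
Lemma due_eq : due = p * (f + (1 - f) * u 1).
Proof.
have shift i : (i <= N)%N -> due = L (fun x => (nth false x.2 i)%:R).
  elim: i => [_|i IHi lt_iN].
    by congr L; apply/funext => -[q [|c l]].
  rewrite (IHi (ltnW lt_iN)) -(@L_onestep (fun x => (nth false x.2 i)%:R)) //.
  apply: L_eq; auto => -[q [|c l]] //= [sz].
  by rewrite /onestep /lstep /= !nth_rcons sz lt_iN; ring.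
rewrite (shift N) // -(@L_onestep (fun x => (nth false x.2 N)%:R)) //.
have -> : p * (f + (1 - f) * u 1) = (p * f) * L (fun=> 1) + (p * (1 - f)) * u 1.
  by rewrite L_1; ring.
rewrite -L_lin; auto; apply: L_eq; auto => -[q [|c l]] //= [sz].
rewrite /onestep /lstep /= !nth_rcons sz ltnn eqxx.
by case: c; case: q => [|q] //=; rewrite ?addn0 ?addn1 //=; ring.
Qed.

(* Flow conservation, from the invariance of the mean of min(q, M) as M grows;
   the mean of q itself might be infinite. *)
Lemma flow : (1 - f) * L (fun x => (~~ head false x.2 && (0 < x.1)%N)%:R) <= f * due.
Proof.
set s := L _.
have trunc M : (1 - f) * s <= f * due + (1 - f) * L (fun x => (M <= x.1)%N%:R).
  pose h (x : state) : R := (minn x.1 M)%:R.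
  have bh : bnd h.
    by exists M%:R => x; rewrite ger0_norm // ler_nat geq_minr.
  have : L (fun x => 1 * onestep h x + (- 1) * h x) = 0.
    by rewrite L_lin; auto; rewrite L_onestep // mul1r mulN1r subrr.
  (* A pointwise comparison with the drift of [minn q M]; the indicator of [M <= q] pays for
     departures hidden by the truncation. *)
  suff : L (fun x => 1 * ((1 - f) * (~~ head false x.2 && (0 < x.1)%N)%:R) +
       1 * (1 * onestep h x + (- 1) * h x)) <=
      L (fun x => f * (head false x.2)%:R + (1 - f) * (M <= x.1)%N%:R).
    rewrite L_lin; auto 20; rewrite [X in _ <= X]L_lin; auto; rewrite L_scale; auto.
    rewrite -/s -/due !mul1r.
    by move=> h1 h2; lra.
  apply: L_le; auto 20 => -[q [|c l]] //= _.
  rewrite /onestep /lstep /h /=.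
  have ? := f_gt0; have ? := f_lt1.
  have cases : (M <= q)%N \/ (q < M)%N by lia.
  case: c => /=.
    have -> : minn (q + 0)%N M = minn q M by rewrite addn0.
    have : (minn (q + 1) M)%:R <= 1 + (minn q M)%:R :> R.
      by rewrite nat1r ler_nat; lia.
    have : 0 <= (M <= q)%N%:R :> R by [].
    move: (minn (q + 1) M)%:R (minn q M)%:R (M <= q)%N%:R => y1 y2 y3 *; nra.
  case: q cases => [|q] /= cases.
    rewrite !addn0 /= min0n ?add0n /=.
    by have : 0 <= (M <= 0)%N%:R :> R by []; nra.
  rewrite addn0 addn1 /=.
  have : 1 + (minn q M)%:R <= (minn q.+1 M)%:R + (M <= q.+1)%N%:R :> R.
    by rewrite nat1r -natrD ler_nat; case: leqP; lia.
  move: (minn q M)%:R (minn q.+1 M)%:R (M <= q.+1)%N%:R => y1 y2 y3 *; nra.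
have h : (fun M => f * due + (1 - f) * L (fun x => (M <= x.1)%N%:R)) @ \oo -->
    f * due + (1 - f) * 0.
  by apply: cvgD; [exact: cvg_cst | apply: cvgMr; exact: L_tail].
rewrite mulr0 addr0 in h.
rewrite -(cvg_lim _ h) //; apply: limr_ge; first by apply/cvg_ex; eexists; exact: h.
by near=> M; exact: trunc.
Unshelve. all: by end_near. Qed.

(** [u 1] splits into [due] and the left mean of [flow], whence (1-f) u(1) <= due; [due_eq] then
    gives (1-f)(1-p) u(1) <= f p. *)
Lemma u1_le : u 1 <= f / (1 - p) * (p / (1 - f)).
Proof.
have e : u 1 = 1 * due + 1 * L (fun x => (~~ head false x.2 && (0 < x.1)%N)%:R).
  rewrite -L_lin; auto; apply: L_eq; auto => -[q [|c l]] //= _.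
  by case: c; case: q => [|q] /=; ring.
have := flow; have := due_eq; rewrite e !mul1r.
set s := L _ => e1 e2; have ? := f_lt1; have ? := p_lt1.
have -> : f / (1 - p) * (p / (1 - f)) = f * p / ((1 - p) * (1 - f)).
  by field; rewrite !subr_eq0 !gt_eqF.
rewrite ler_pdivlMr ?mulr_gt0 ?subr_gt0 //; nra.
Qed.

Lemma clear_bound n : (0 < n)%N ->
  L (fun x => clear p n x.1.+1 x.2) <= f / (1 - p) * (p / (1 - f)) ^+ n.
Proof.
case: n => // n _; elim: n => [|n IHn]; first exact: u1_le.
have f1 : 0 < 1 - f by rewrite subr_gt0.
rewrite -/(u n.+2) [_ ^+ n.+2]exprSr mulrA.
apply: (@le_trans _ _ (u n.+1 * (p / (1 - f)))).
  by rewrite mulrA ler_pdivlMr // mulrC [u _ * p]mulrC u_decay.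
by rewrite ler_wpM2r // divr_ge0 ?(ltW p_gt0) ?(ltW f1).
Qed.

End Stationary.
(** * Summing over the attempts *)

Section FailureSums.
Variables (R : realFieldType) (p : R).

(** The weights p^i (1-p) are the law of the number of failures before the first success; its tail
    from [m] on is split at [K]. *)
Lemma expr_tail_sum (m K : nat) : (m <= K)%N ->
  p ^+ m = p ^+ K + \sum_(i < K) p ^+ i * (1 - p) * (m <= i)%N%:R.
Proof.
elim: K => [|K IHK]; first by rewrite leqn0 => /eqP ->; rewrite big_ord0 addr0.
rewrite leq_eqVlt ltnS big_ord_recr /= => /orP[/eqP ->|le_mK].
  rewrite big1 => [|i _]; first by rewrite ltnn mulr0 !addr0.
  by rewrite leqNgt ltnS (ltnW (ltn_ord i)) mulr0.
by rewrite (IHK le_mK) le_mK exprS mulr1; ring.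
Qed.

Lemma telescope_from (u : nat -> R) a n : (a <= n)%N ->
  \sum_(t < n) (u t - u t.+1) * (a <= t)%N%:R = u a - u n.
Proof.
elim: n => [|n IHn]; first by rewrite leqn0 => /eqP ->; rewrite big_ord0 subrr.
rewrite leq_eqVlt ltnS big_ord_recr /= => /orP[/eqP ->|le_an].
  rewrite big1 => [|i _]; first by rewrite ltnn mulr0 addr0 subrr.
  by rewrite leqNgt ltnS (ltnW (ltn_ord i)) mulr0.
by rewrite (IHn le_an) le_an mulr1; ring.
Qed.

(** Here u(t) is to be the probability of waiting at least t slots. The left side sums over the
    wait, the right side over the number i of failures, given which lateness means a wait of at
    least N + 1 - (i+1) S. *)
Lemma delay_sum (u : nat -> R) (N S : nat) : (0 < S)%N -> u 0%N = 1 ->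
  \sum_(t < N.+1) (u t - u t.+1) * p ^+ ((N - t) %/ S) + u N.+1 =
  p ^+ (N %/ S) + \sum_(i < N %/ S) p ^+ i * (1 - p) * u (N.+1 - i.+1 * S)%N.
Proof.
move=> S0 u0; set K := (N %/ S)%N.
have E (t : 'I_N.+1) : (u t - u t.+1) * p ^+ ((N - t) %/ S) =
  (u t - u t.+1) * p ^+ K + \sum_(i < K) p ^+ i * (1 - p) *
    ((u t - u t.+1) * (N.+1 - i.+1 * S <= t)%N%:R).
  rewrite (@expr_tail_sum _ K); last by rewrite leq_div2r // leq_subr.
  rewrite mulrDr; congr (_ + _); rewrite mulr_sumr; apply: eq_bigr => i _.
  have -> : ((N - t) %/ S <= i)%N = (N.+1 - i.+1 * S <= t)%N.
    have := ltn_ord t; rewrite -[LHS]ltnS ltn_divLR //; lia.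
  by ring.
rewrite (eq_bigr _ (fun t _ => E t)) big_split /= -mulr_suml.
have -> : \sum_(t < N.+1) (u t - u t.+1) = u 0%N - u N.+1.
  by rewrite -(telescope_from u (leq0n N.+1)); apply: eq_bigr => t _; rewrite mulr1.
rewrite exchange_big /= u0 (eq_bigr (fun i : 'I_K => p ^+ i * (1 - p) *
  u (N.+1 - i.+1 * S)%N - p ^+ i * (1 - p) * u N.+1)); last first.
  move=> i _; rewrite -mulr_sumr telescope_from ?mulrBr //; lia.
rewrite sumrB -mulr_suml.
have : \sum_(i < K) p ^+ i * (1 - p) = 1 - p ^+ K.
  have := @expr_tail_sum 0 K isT; rewrite expr0.
  by under eq_bigr do rewrite mulr1; move=> e; lra.
by move=> ->; ring.
Qed.

(** Since (1-f) r = p, the factor turns the i-th term into p^i r^(N - i(s+1)) - p^(i+1) r^(N -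
    (i+1)(s+1)), and the sum telescopes. *)
Lemma geometric_delay_sum (f r : R) (N s K : nat) : r != 0 -> p = r * (1 - f) ->
  (K * s.+1 <= N)%N ->
  (\sum_(i < K) p ^+ i * r ^+ (N.+1 - i.+1 * s.+1)) * (f + r ^+ s - 1) =
  r ^+ N - p ^+ K * r ^+ (N - K * s.+1).
Proof.
move=> r0 pE; elim: K => [|K IHK] le_KN.
  by rewrite big_ord0 mul0r subn0 mul1r subrr.
rewrite big_ord_recr /= mulrDl IHK; last by lia.
set e := (N - K.+1 * s.+1)%N.
have -> : (N - K * s.+1 = e.+1 + s)%N by rewrite /e; lia.
have -> : (N.+1 - K.+1 * s.+1 = e.+1)%N by rewrite /e; lia.
by rewrite exprD [p ^+ K.+1]exprS [in X in X * p ^+ K]pE [r ^+ e.+1]exprS; ring.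
Qed.

End FailureSums.

(** * The delay along a trajectory *)

Lemma leastP (P : pred nat) n : P n -> (forall m, (m < n)%N -> ~~ P m) ->
  least P = Some n.
Proof.
move=> Pn Pmin; rewrite /least; case: pselect => [h|]; last by case; exists n.
case: ex_minnP => m Pm m_min; congr Some; apply/eqP; rewrite eqn_leq m_min //=.
by rewrite leqNgt; apply: contraL Pm; exact: Pmin.
Qed.

Lemma least_le (P : pred nat) n : P n -> exists m, [/\ least P = Some m, P m & (m <= n)%N].
Proof.
move=> Pn; rewrite /least; case: pselect => [h|]; last by case; exists n.
by case: ex_minnP => m Pm m_min; exists m; split => //; exact: m_min.
Qed.

Lemma least_some (P : pred nat) n : least P = Some n -> P n.
Proof.
rewrite /least; case: pselect => // h [<-].
by case: ex_minnP.
Qed.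

Section Trajectory.
Variables (zeta delta : nat) (x : int -> arq_state zeta delta).
Variables (a e : int -> bool) (k : int).
Hypothesis xS : forall j, x (j + 1) = arq_step (x j) (a j) (e j).
Hypothesis ak : a k.

Notation S := (1 + zeta + delta)%N.

(* The retransmission flags of the slots k, k+1, ... seen by a packet arriving
   in slot k, as long as it waits: every slot is then used. *)
Definition flag (i : nat) : bool :=
  if (i < S)%N then nth false (x k).2 i else e (k + (i - S)%N%:Z).

Fixpoint free_slots (n : nat) : nat :=
  if n is n'.+1 then (free_slots n' + ~~ flag n')%N else 0%N.

Lemma free_homo m n : (m <= n)%N -> (free_slots m <= free_slots n)%N.
Proof.
move=> /subnK <-; elim: (n - m)%N => // j IHj.
by rewrite addSn /=; lia.
Qed.

(** A waiting packet is itself in the queue, so every slot is used and every failure raises a flag.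
    The third conclusion, that the queue exceeds the packets ahead, carries this through the
    induction. *)
Lemma waiting_path n : (free_slots n <= waiting (x k))%N ->
  [/\ (x (k + n%:Z)).2 = mkseq (fun i => flag (n + i)) S :> seq bool,
      ahead x k n = (waiting (x k) - free_slots n)%N &
      (waiting (x k) - free_slots n < waiting (x (k + n%:Z)) + a (k + n%:Z))%N].
Proof.
elim: n => [|n IHn] le_free.
  rewrite addr0 subn0 ak addn1; split => //.
  apply: (@eq_from_nth _ false); first by rewrite size_tuple size_mkseq.
  move=> i; rewrite size_tuple => lt_iS.
  by rewrite nth_mkseq // add0n /flag lt_iS.
have [|x2 ah wt] := IHn; first exact: leq_trans (free_homo (leqnSn n)) le_free.
have due : retx_due (x (k + n%:Z)) = flag n.
  by rewrite /retx_due x2 nth_mkseq ?addn0.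
have xE : x (k + n.+1%:Z) = arq_step (x (k + n%:Z)) (a (k + n%:Z)) (e (k + n%:Z)).
  by rewrite -xS -addrA -PoszD addn1.
have sent : retx_due (x (k + n%:Z)) ||
    (0 < waiting (x (k + n%:Z)) + a (k + n%:Z))%N by apply/orP; right; lia.
rewrite /= in le_free.
split.
- rewrite xE /= sent andTb x2.
  apply: (@eq_from_nth _ false).
    by rewrite size_rcons size_behead !size_mkseq; lia.
  move=> i; rewrite size_rcons size_behead size_mkseq => lt_iS.
  rewrite [RHS]nth_mkseq; last by lia.
  rewrite nth_rcons size_behead size_mkseq nth_behead.
  case: ltnP => le_i; first by rewrite nth_mkseq ?addnS //; lia.
  rewrite ifT; last by lia.
  rewrite /flag ifF; last by lia.
  (* Only index [S - 1] is left: the new flag is the outcome of slot [k + n]. *)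
  by congr (e (k + _%:Z)); lia.
- by rewrite /= due ah; case: (flag n) le_free => /=; lia.
- rewrite xE /= due /waiting /=.
  by move: wt le_free; rewrite /waiting /=; case: (flag n) => /=; lia.
Qed.

Lemma wait_free t : (free_slots t <= waiting (x k) < free_slots t.+1)%N ->
  wait x k = Some t.
Proof.
move=> /andP[le_t lt_t]; apply: leastP => [|n lt_nt].
  have [x2 ah _] := waiting_path le_t.
  rewrite /retx_due x2 nth_mkseq ?addn0 // ah.
  by move: lt_t => /=; case: (flag t) => /=; lia.
have le_n : (free_slots n <= waiting (x k))%N by apply: leq_trans le_t; apply: free_homo; lia.
have [x2 ah _] := waiting_path le_n.
rewrite /retx_due x2 nth_mkseq ?addn0 // ah.
have := free_homo lt_nt; rewrite /=.
by case: (flag n) => //=; lia.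
Qed.

(** With [m] attempts the service delay is [m * S - delta], so after a wait [t] the total delay is
    at most [D] iff [t + m * S <= N]; hence [N = D + delta], and lateness means that the first
    [(N - t) %/ S] attempts fail. *)
Lemma delay_cover (R : realType) (T d : R) (D N : nat) :
  0 < T -> D%:R <= d / T -> N = (D + delta)%N ->
  (d%:E < total_delay R x e k * T%:E)%E ->
  (exists2 t, (t <= N)%N & (free_slots t <= waiting (x k) < free_slots t.+1)%N /\
     forall i, (i < (N - t) %/ S)%N -> e (k + (t + i * S)%N%:Z)) \/
  (free_slots N.+1 <= waiting (x k))%N.
Proof.
move=> T0 DdT NE late.
case: (leqP (free_slots N.+1) (waiting (x k))) => [|lt_N]; [by right | left].
have [t tP t_min] := @ex_minnP (fun t => waiting (x k) < free_slots t.+1)%N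
  (ex_intro _ N lt_N).
have le_tN : (t <= N)%N by apply: t_min.
have le_t : (free_slots t <= waiting (x k))%N.
  case: t tP t_min {le_tN} => // t _ t_min.
  by rewrite leqNgt; apply/negP => /t_min; rewrite ltnn.
have w_t : wait x k = Some t by apply: wait_free; rewrite le_t.
exists t => //; split; first by rewrite le_t.
move=> i lt_i; apply/negPn/negP => ok_i.
have [|m [mE /andP[m0 _] le_m]] := @least_le (fun m => (0 < m)%N &&
  ~~ e (k + (t + (m - 1) * S)%N%:Z)) i.+1; first by rewrite /= subn1 ok_i.
have att : attempts x e k = Some m by rewrite /attempts w_t.
move: late; rewrite /total_delay /wait_delay /service_delay att w_t /=.
rewrite -EFinD -natrD -EFinM lte_fin ltNge => /negP; apply.
rewrite -ler_pdivlMr // (le_trans _ DdT) // ler_nat.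
have : (i.+1 * S <= N - t)%N by rewrite -leq_divRL.
have : (m * S <= i.+1 * S)%N by rewrite leq_mul2r le_m orbT.
move: (i.+1 * S)%N => y; rewrite !mulnDr muln1 mulnBl mul1n.
have : (delta <= m * delta)%N by rewrite leq_pmull.
lia.
Qed.

Lemma delay_gt (R : realType) (T d : R) (D t s : nat) :
  0 < T -> d / T < D.+1%:R -> (D < t + s)%N ->
  (d%:E < (t%:R%:E + s%:R%:E) * T%:E)%E.
Proof.
move=> T0 dTD lt_D; rewrite -EFinD -natrD -EFinM lte_fin -ltr_pdivrMr //.
by apply: lt_le_trans dTD _; rewrite ler_nat.
Qed.

(** The description is exact, so the late event will equal a finite union of measurable cells. A
    packet never sent, or never successful, has infinite delay. *)
Lemma delay_cover_conv (R : realType) (T d : R) (D N : nat) :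
  0 < T -> d / T < D.+1%:R -> N = (D + delta)%N ->
  (exists2 t, (t <= N)%N & (free_slots t <= waiting (x k) < free_slots t.+1)%N /\
     forall i, (i < (N - t) %/ S)%N -> e (k + (t + i * S)%N%:Z)) \/
  (free_slots N.+1 <= waiting (x k))%N ->
  (d%:E < total_delay R x e k * T%:E)%E.
Proof.
move=> T0 dTD NE cover; rewrite /total_delay /wait_delay /service_delay.
have T0E : (0 < T%:E)%E by rewrite lte_fin.
case: cover => [[t le_tN [w_t fails]]|le_free].
  have wE := wait_free w_t; rewrite wE /=.
  case att: (attempts x e k) => [m|] /=; last by rewrite addey // gt0_mulye // ltry.
  move: att; rewrite /attempts wE => /least_some /andP[m0 ok_m].
  apply: (delay_gt T0 dTD).
  have le_m : ((N - t) %/ S <= m - 1)%N.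
    by rewrite leqNgt; apply/negP => /fails; rewrite (negbTE ok_m).
  have : (N - t < m * S)%N by rewrite -ltn_divLR //; lia.
  rewrite !mulnDr muln1 mulnBl mul1n.
  have : (delta <= m * delta)%N by rewrite leq_pmull.
  lia.
case wE: (wait x k) => [t|] /=; last first.
  by rewrite /attempts wE /= addye // gt0_mulye // ltry.
have lt_Nt : (N < t)%N.
  rewrite ltnNge; apply/negP => le_tN; move/least_some: wE.
  have le_t : (free_slots t <= waiting (x k))%N.
    by apply: leq_trans le_free; apply: free_homo; lia.
  have [x2 ah _] := waiting_path le_t.
  rewrite /retx_due x2 nth_mkseq ?addn0 // ah.
  have lt_w : (free_slots t + ~~ flag t <= waiting (x k))%N.
    exact: leq_trans (free_homo (le_tN : (t.+1 <= N.+1)%N)) le_free.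
  move: lt_w; case: (flag t) => //= lt_w /eqP; lia.
case: (attempts x e k) => [m|] /=; last by rewrite addey // gt0_mulye // ltry.
by apply: (delay_gt T0 dTD); lia.
Qed.

End Trajectory.

(** * The stationary law *)

Section StateSpace.
Variables zeta delta : nat.

(** The state space is countable, and singletons are measurable as finite intersections of
    coordinate conditions. *)
Lemma measurable_arq_state (S : set (arq_state zeta delta)) : measurable S.
Proof.
apply: countable_measurable => [[n t]|]; last first.
  exact: (@countableP (nat * (1 + zeta + delta).-tuple bool)%type).
have -> : [set (n, t)] = [set n] `*` (\bigcap_(i in [set: 'I_(1 + zeta + delta)])
    (fun s : (1 + zeta + delta).-tuple bool => tnth s i) @^-1` [set tnth t i]).
  apply/seteqP; split => -[m s] /=; first by move=> [-> ->].
  by move=> [-> st]; congr pair; apply: eq_from_tnth => i; exact: st.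
apply: measurableX => //; apply: fin_bigcap_measurable => // i _.
by rewrite -[X in measurable X]setTI; exact: measurable_tnth.
Qed.

Lemma measurable_fun_arq_state d (T : measurableType d)
  (f : arq_state zeta delta -> T) : measurable_fun setT f.
Proof. by move=> _ Y _; exact: measurable_arq_state. Qed.

Definition arq_next (a e : bool) (x : arq_state zeta delta) := arq_step x a e.

HB.instance Definition _ a e := isMeasurableFun.Build _ _ _ _ (arq_next a e)
  (measurable_fun_arq_state (arq_next a e)).

(** Countable additivity over singletons, enumerated by [pickle]: each [F n] holds at most one
    state. *)
Lemma eq_arq_measure (R : realType) (m1 m2 : {measure set (arq_state zeta delta) -> \bar R}) :
  (forall x, m1 [set x] = m2 [set x]) -> forall S, m1 S = m2 S.
Proof.
move=> m12 S.
pose F n : set (arq_state zeta delta) := [set x | S x /\ pickle (x : nat * _) = n].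
have SF : S = \bigcup_n F n.
  apply/seteqP; split => [x Sx|x [n _ []//]]; by exists (pickle (x : nat * _)).
have tF : trivIset setT F.
  apply/trivIsetP => i j _ _ /eqP ij; rewrite -subset0 => x [[_ ei] [_ ej]].
  by apply: ij; rewrite -ei -ej.
have mF n : measurable (F n) by exact: measurable_arq_state.
rewrite SF !measure_bigcup //; apply: eq_eseriesr => n _.
have [->|/set0P[x Fx]] := eqVneq (F n) set0; first by rewrite !measure0.
have -> : F n = [set x]; last exact: m12.
apply/seteqP; split => [y [_ yn]|y -> //]; case: Fx => _ xn.
by apply: (@pcan_inj _ _ _ _ (@pickleK (nat * _)%type)); rewrite xn yn.
Qed.

End StateSpace.

(** * From an invariant probability to the abstract expectation *)

Section Law.
Context (R : realType) (disp : measure_display) (U : measurableType disp).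
Variables (N : nat) (st : U -> nat * seq bool) (next : bool -> bool -> {mfun U >-> U}).
Hypotheses (mU : forall S : set U, measurable S)
  (size_st : forall x, size (st x).2 = N.+1)
  (st_next : forall a e x, st (next a e x) = lstep (st x) a e).
Variable nu : probability U R.

Definition law (h : nat * seq bool -> R) : R := \int[nu]_x h (st x).

Lemma law_integrable (h : nat * seq bool -> R) : bnd h ->
  nu.-integrable setT (EFin \o (fun x => h (st x))).
Proof.
move=> [C hC]; apply: measurable_bounded_integrable => //.
- by rewrite -ge0_fin_numE //; exact: fin_num_measure.
- by exists C; split; [exact: num_real | move=> M CM x _; exact: le_trans (hC _) (ltW CM)].
Qed.

Lemma law_lin a b g h : bnd g -> bnd h ->
  law (fun x => a * g x + b * h x) = a * law g + b * law h.
Proof.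
move=> bg bh; rewrite /law RintegralD // ?RintegralZl //; try exact: law_integrable.
  exact: (law_integrable (bndM (bnd_cst a) bg)).
exact: (law_integrable (bndM (bnd_cst b) bh)).
Qed.

Lemma law_le g h : bnd g -> bnd h ->
  (forall x, size x.2 = N.+1 -> g x <= h x) -> law g <= law h.
Proof.
move=> bg bh gh; apply: le_Rintegral => //; try exact: law_integrable.
by move=> x _; apply: gh; rewrite size_st.
Qed.

Lemma law_cst : law (fun=> 1) = 1.
Proof.
transitivity (1 * fine (nu setT)); first exact: Rintegral_cst.
by rewrite probability_setT mul1r.
Qed.

Lemma law_indic (B : nat * seq bool -> bool) :
  law (fun x => (B x)%:R) = fine (nu [set x | B (st x)]).
Proof.
rewrite /law /Rintegral; congr fine.
transitivity (\int[nu]_x (\1_[set x | B (st x)] x)%:E)%E.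
  by apply: eq_integral => x _; rewrite indicE mem_setE.
by rewrite integral_indic ?setIT.
Qed.

Lemma law_tail : (fun m => law (fun x => (m <= x.1)%N%:R)) @ \oo --> (0 : R).
Proof.
pose G m : set U := [set x | (m <= (st x).1)%N].
have G0 : \bigcap_m G m = set0.
  by apply/seteqP; split => // x /(_ (st x).1.+1 I); rewrite /G /= ltnn.
have : nu \o G @ \oo --> nu (\bigcap_m G m).
  apply: nonincreasing_cvg_mu => //.
  - by rewrite -ge0_fin_numE //; exact: fin_num_measure.
  - by move=> m n mn; apply/subsetPset => x; exact: leq_trans.
rewrite G0 measure0 => /fine_cvg; rewrite /=.
by under [X in _ -> X @ _ --> _]eq_fun do rewrite law_indic.
Qed.

Variables (f p : R).
Hypotheses (f_ge0 : 0 <= f) (f_le1 : f <= 1) (p_ge0 : 0 <= p) (p_le1 : p <= 1).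
Hypothesis nu_step : forall S, nu S =
  ((f * p)%:E * nu (next true true @^-1` S) +
   (f * (1 - p))%:E * nu (next true false @^-1` S) +
   ((1 - f) * p)%:E * nu (next false true @^-1` S) +
   ((1 - f) * (1 - p))%:E * nu (next false false @^-1` S))%E.

Let next_int a e (h : nat * seq bool -> R) : bnd h ->
  nu.-integrable setT (EFin \o (fun x => h (lstep (st x) a e))).
Proof.
by move=> bh; apply: (law_integrable (bnd_comp (fun x => lstep x a e) bh)).
Qed.

(** By [nu_step], [nu] is the mixture [mu] of its four images under [next]; nonnegativity lets the
    integral be split over the mixture. *)
Lemma law_onestep_ge0 h : bnd h -> (forall x, 0 <= h x) ->
  law (onestep f p h) = law h.
Proof.
move=> bh h0.
have w1 : 0 <= f * p by rewrite mulr_ge0.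
have w2 : 0 <= f * (1 - p) by rewrite mulr_ge0 // subr_ge0.
have w3 : 0 <= (1 - f) * p by rewrite mulr_ge0 // subr_ge0.
have w4 : 0 <= (1 - f) * (1 - p) by rewrite mulr_ge0 // subr_ge0.
pose m a e (c : {nonneg R}) : {measure set U -> \bar R} := mscale c (distribution nu (next a e)).
pose mu : {measure set U -> \bar R} := 
  measure_add (measure_add (measure_add (m true true (NngNum w1))
  (m true false (NngNum w2))) (m false true (NngNum w3))) (m false false (NngNum w4)).
pose g (x : U) := (h (st x))%:E.
have mg D : measurable_fun D g.
  by move=> ? ? _; exact: mU.
have g0 x : (0 <= g x)%E by rewrite lee_fin.
have gE : (\int[nu]_x g x = \int[mu]_x g x)%E.
  apply: eq_measure_integral => S _ _.
  apply: etrans (nu_step S) _; apply/esym.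
  do 3! (apply: etrans (measure_addE _ _ _) _; congr (_ + _)%E).
have stepE a e : (\int[distribution nu (next a e)]_x g x =
    (\int[nu]_x h (lstep (st x) a e))%:E)%E.
  rewrite ge0_integral_distribution //.
  rewrite /Rintegral fineK; last first.
    exact: (integrable_fin_num measurableT (next_int a e bh)).
  by apply: eq_integral => x _; rewrite /= /g st_next.
have -> : law h = fine (\int[nu]_x g x) by [].
rewrite gE /mu !ge0_integral_measure_add //; try exact: mg.
rewrite !ge0_integral_mscale //; try exact: mg.
rewrite !stepE -!EFinM -!EFinD /=.
have bs a e : bnd (fun x => h (lstep x a e)) := bnd_comp (fun x => lstep x a e) bh.
rewrite /onestep law_lin; try by do !(apply: bndD || apply: bndM || exact: bnd_cst || exact: bs).
rewrite !law_lin; try exact: bs.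
by rewrite /law; ring.
Qed.

Lemma law_onestep h : bnd h -> law (onestep f p h) = law h.
Proof.
move=> bh; have [C hC] := bh.
(* Adding the bound [C] makes [h] nonnegative, and [onestep] preserves constants. *)
have h_ge0 x : 0 <= 1 * h x + C * 1.
  by rewrite mul1r mulr1 -lerBlDr sub0r; have := hC x; rewrite ler_norml => /andP[].
have := law_onestep_ge0 (bndD (bndM (bnd_cst 1) bh) (bndM (bnd_cst C) (bnd_cst 1))) h_ge0.
rewrite [RHS]law_lin // ?law_cst; last exact: bnd_cst.
have -> : onestep f p (fun x => 1 * h x + C * 1) = (fun x => 1 * onestep f p h x + C * 1).
  by apply/funext => x; rewrite /onestep; ring.
rewrite law_lin ?law_cst; [|exact: bnd_onestep|exact: bnd_cst].
by move=> /addIr; rewrite !mul1r.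
Qed.

End Law.

(** * Probabilities of arrival and failure patterns *)

Section Patterns.
Variables (R : realFieldType).

Definition weight (c : R) (b : bool) : R := if b then c else 1 - c.

Fixpoint patterns (n : nat) : seq (seq bool) :=
  if n is n'.+1 then map (cons true) (patterns n') ++ map (cons false) (patterns n')
  else [:: [::]].

Lemma mem_patterns n s : (s \in patterns n) = (size s == n).
Proof.
elim: n s => [|n IHn] [|b s] //=; rewrite mem_cat.
  by apply/norP; split; apply/mapP => -[].
by case: b; rewrite ?mem_map ?IHn //; try (by move=> ? ? []);
  (rewrite [X in _ || X](introF mapP) || rewrite [X in X || _](introF mapP));
  rewrite ?orbF //; case.
Qed.

Variable p : R.

Definition pattern_weight (s : seq bool) : R := \prod_(b <- s) weight p b.

Lemma patterns_rec n (F : seq bool -> R) :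
  \sum_(s <- patterns n.+1) pattern_weight s * F s =
  p * (\sum_(s <- patterns n) pattern_weight s * F (true :: s)) +
  (1 - p) * (\sum_(s <- patterns n) pattern_weight s * F (false :: s)).
Proof.
rewrite /= big_cat !big_map !mulr_sumr /=.
by congr (_ + _); apply: eq_bigr => s _; rewrite /pattern_weight big_cons mulrA.
Qed.

Lemma sum_pattern_weight n : \sum_(s <- patterns n) pattern_weight s = 1.
Proof.
elim: n => [|n IHn]; first by rewrite big_seq1 /pattern_weight big_nil.
have E b : \sum_(s <- patterns n) pattern_weight (b :: s) = weight p b.
  under eq_bigr do rewrite /pattern_weight big_cons.
  by rewrite -mulr_sumr IHn mulr1.
by rewrite /= big_cat !big_map /= !E subrKC.
Qed.

(** Counts slots free of retransmissions, which may well be used for a first transmission. *)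
Definition idle_count (n : nat) (s : seq bool) : nat := count negb (take n s).

(** The recursion unfolded into the probability it stands for: [m] independent flags appended to [l]
    cover the horizon [n]. *)
Lemma clear_patterns n Q l m : (n <= size l + m)%N ->
  clear p n Q l = \sum_(s <- patterns m) pattern_weight s *
     (idle_count n (l ++ s) < Q)%N%:R.
Proof.
rewrite /idle_count.
elim: n Q l m => [|n IHn] Q [|b l] m le_nm.
- by under eq_bigr do rewrite take0; rewrite -mulr_suml sum_pattern_weight mul1r.
- by under eq_bigr do rewrite take0; rewrite -mulr_suml sum_pattern_weight mul1r.
- case: m le_nm => [|m] // le_nm.
  rewrite patterns_rec /= (IHn Q [::] m) // (IHn Q.-1 [::] m) //.
  congr (_ * _ + _ * _); apply: eq_bigr => s _; congr (_ * _%:R) => /=.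
  by rewrite add1n; case: (Q).
- rewrite clear_cons (IHn _ l m) //; apply: eq_bigr => s _; congr (_ * _%:R).
  by rewrite /=; case: (b); rewrite ?add0n ?add1n //; case: (Q).
Qed.

End Patterns.

Section UnionBound.
Context (disp : measure_display) (Omega : measurableType disp) (R : realType).
Variable P : probability Omega R.

Lemma measurable_bigsetU_seq (I : eqType) (l : seq I) (B : I -> set Omega) :
  (forall i, i \in l -> measurable (B i)) -> measurable (\big[setU/set0]_(i <- l) B i).
Proof.
by move=> mB; rewrite big_seq; apply: bigsetU_measurable.
Qed.

Lemma union_bound (I : eqType) (l : seq I) (B : I -> set Omega) :
  (forall i, i \in l -> measurable (B i)) ->
  fine (P (\big[setU/set0]_(i <- l) B i)) <= \sum_(i <- l) fine (P (B i)).
Proof.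
elim: l => [|i l IHl] mB; first by rewrite !big_nil measure0.
have mBi : measurable (B i) by apply: mB; rewrite mem_head.
have mBl : measurable (\big[setU/set0]_(j <- l) B j).
  by apply: measurable_bigsetU_seq => j jl; apply: mB; rewrite inE jl orbT.
rewrite !big_cons (le_trans (_ : _ <= fine (P (B i)) +
  fine (P (\big[setU/set0]_(j <- l) B j)))) //.
  rewrite -fineD ?fin_num_measure // fine_le ?fin_numD ?fin_num_measure //.
    exact: measurableU.
  by apply: measureU2.
by rewrite lerD2l IHl // => j jl; apply: mB; rewrite inE jl orbT.
Qed.

Lemma measurable_bool_rv (Y : {RV P >-> bool}) b : measurable (Y @^-1` [set b]).
Proof. by apply: measurable_funPTI. Qed.

Lemma measure_bool_split (Y : {RV P >-> bool}) (Z : set Omega) : measurable Z ->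
  P Z = (P (Z `&` Y @^-1` [set true]) + P (Z `&` Y @^-1` [set false]))%E.
Proof.
move=> mZ; rewrite addeC (measureDI P mZ (measurable_bool_rv Y true)).
congr (P _ + _)%E; apply/seteqP; split => w /= [Zw]; first by case: (Y w) => // /(_ erefl).
by move=> ->; split.
Qed.

End UnionBound.

(** * The stationary system and the tail of its wait *)

Section SteadyState.
Variables (R : realType) (disp : measure_display) (Omega : measurableType disp)
  (P : probability Omega R) (f p : R) (zeta delta : nat)
  (A E : int -> {RV P >-> bool}) (X : int -> {RV P >-> arq_state zeta delta}).
Hypotheses (f_gt0 : 0 < f) (f_lt1 : f < 1) (p_gt0 : 0 < p) (p_lt1 : p < 1)
  (fp_lt1 : f + p < 1).
Hypothesis arq : steady_arq f p A E X.

Lemma fine_prob_bool (Y : {RV P >-> bool}) c b : P [set w | Y w] = c%:E ->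
  fine (P (Y @^-1` [set b])) = weight c b.
Proof.
move=> Yc; have -> : Y @^-1` [set b] = if b then [set w | Y w] else ~` [set w | Y w].
  apply/seteqP; split => w /=; case: b => //=.
  - by move=> ->.
  - by case: (Y w) => // /(_ isT).
have mY : measurable [set w | Y w].
  exact: (measurable_bool_rv Y true).
by case: b => /=; rewrite ?probability_setC // Yc.
Qed.

Definition pattern k (S : set (arq_state zeta delta)) (a : bool) (I : seq nat)
    (es : nat -> bool) : set Omega :=
  [set w | [/\ S (X k w), A k w = a &
     forall i, i \in I -> E (k + i%:Z) w = es i]].

(** The state before slot [k], the arrival in it and the outcomes from it on are independent; [J]
    lists the coordinates involved. *)
Lemma prob_pattern k S a I es : uniq I -> measurable (pattern k S a I es) /\
  fine (P (pattern k S a I es)) =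
  fine (P (X k @^-1` S)) * weight f a * \prod_(i <- I) weight p (es i).
Proof.
move=> uI.
pose J : seq (unit + (nat + nat)) := inl tt :: inr (inl 0%N) :: [seq inr (inr i) | i <- I].
pose B (j : unit + (nat + nat)) : set Omega := match j with
  | inl _ => X k @^-1` S
  | inr (inl n) => A (k + n%:Z) @^-1` [set a]
  | inr (inr n) => E (k + n%:Z) @^-1` [set es n] end.
have mB j : measurable (B j).
  case: j => [u|[n|n]] /=; apply: measurable_funPTI => //.
  exact: measurable_arq_state.
have uJ : uniq J.
  rewrite /J /= inE /=; apply/and3P; split.
  - by apply/negP => /mapP[].
  - by apply/negP => /mapP[].
  - by rewrite map_inj_uniq // => i j [].
have BE : pattern k S a I es = \bigcap_(j in [set` J]) B j.
  apply/seteqP; split => w.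
    move=> [Sw Aw Ew] j /=; rewrite !inE => /or3P[/eqP ->|/eqP ->|/mapP[i iI ->]] //=.
      by rewrite addr0.
    exact: Ew.
  move=> Bw; split.
  - by apply: (Bw (inl tt)); rewrite /= inE eqxx.
  - by have := Bw (inr (inl 0%N)); rewrite /= addr0; apply; rewrite !inE eqxx orbT.
  - move=> i iI; apply: (Bw (inr (inr i))); rewrite /= !inE map_f ?orbT //.
split; first by rewrite BE; apply: fin_bigcap_measurable.
rewrite BE (arq_independence arq (k := k) uJ) => [|j _].
  rewrite /= !big_cons big_map /= -mulrA addr0.
  rewrite (fine_prob_bool _ (arq_arrival arq k)); congr (_ * (_ * _)).
  by apply: eq_bigr => i _; rewrite (fine_prob_bool _ (arq_failure arq _)).
case: j => [u|[n|n]] /=.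
- by exists S; [exact: measurable_arq_state | rewrite setTI].
- by exists [set a] => //; rewrite setTI.
- by exists [set es n] => //; rewrite setTI.
Qed.

Lemma arq_stationary_set k l S : P (X k @^-1` S) = P (X l @^-1` S).
Proof.
have e x : distribution P (X k) [set x] = distribution P (X l) [set x].
  exact: (arq_stationary arq).
exact: (eq_arq_measure e S).
Qed.

(** Stationarity replaces [X k] by [X (k + 1)], and the event is then split on the arrival and
    outcome of slot [k]. *)
Lemma arq_law_step k S : P (X k @^-1` S) =
  ((f * p)%:E * P (X k @^-1` (arq_next true true @^-1` S)) +
   (f * (1 - p))%:E * P (X k @^-1` (arq_next true false @^-1` S)) +
   ((1 - f) * p)%:E * P (X k @^-1` (arq_next false true @^-1` S)) +
   ((1 - f) * (1 - p))%:E * P (X k @^-1` (arq_next false false @^-1` S)))%E.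
Proof.
rewrite (arq_stationary_set k (k + 1) S).
have mX j (V : set (arq_state zeta delta)) : measurable (X j @^-1` V).
  by apply: measurable_funPTI => //; exact: measurable_arq_state.
have cell a e : P (X (k + 1) @^-1` S `&` A k @^-1` [set a] `&` E k @^-1` [set e]) =
    ((weight f a * weight p e)%:E * P (X k @^-1` (arq_next a e @^-1` S)))%E.
  have [mV PV] := @prob_pattern k (arq_next a e @^-1` S) a [:: 0%N] (fun=> e) isT.
  have -> : X (k + 1) @^-1` S `&` A k @^-1` [set a] `&` E k @^-1` [set e] =
      pattern k (arq_next a e @^-1` S) a [:: 0%N] (fun=> e).
    apply/seteqP; split => w /=.
      move=> [[Sw Aw] Ew]; split => //.
        by move: Sw; rewrite (arq_evolution arq) Aw Ew.
      by move=> i; rewrite inE => /eqP ->; rewrite addr0.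
    move=> [Sw Aw Ew]; have := Ew 0%N (mem_head _ _); rewrite addr0 => Ekw.
    by split => //; split => //; rewrite (arq_evolution arq) Aw Ekw.
  rewrite -[LHS]fineK ?fin_num_measure // PV big_seq1 -mulrA mulrC EFinM fineK //.
  by rewrite fin_num_measure.
rewrite (measure_bool_split (A k) (mX _ _)).
rewrite !(measure_bool_split (E k) 
  (measurableI _ _ (mX _ _) (measurable_bool_rv _ _))).
by rewrite !cell /= !addeA.
Qed.


Notation S := (1 + zeta + delta)%N.

Let st (x : arq_state zeta delta) : nat * seq bool := (x.1, tval x.2).
Let mean k : (nat * seq bool -> R) -> R := law st (distribution P (X k)).
Let u k n : R := mean k (fun x => clear p n x.1.+1 x.2).

Lemma wait_tail k n : (0 < n)%N -> u k n <= f / (1 - p) * (p / (1 - f)) ^+ n.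
Proof.
have mU (V : set (arq_state zeta delta)) : measurable V by exact: measurable_arq_state.
have szst (x : arq_state zeta delta) : size (st x).2 = (zeta + delta).+1.
  by rewrite size_tuple.
apply: (@clear_bound R f p (zeta + delta)) => //.
- by move=> a b g h bg bh; apply: law_lin.
- by move=> g h bg bh gh; apply: (law_le mU szst).
- exact: law_cst.
- move=> h bh; apply: (law_onestep mU (next := fun a e => arq_next a e)) => //;
    try exact: ltW.
  exact: arq_law_step.
- exact: law_tail.
Qed.

Lemma law_sum k (I : Type) (l : seq I) (c : I -> R) (g : I -> nat * seq bool -> R) :
  (forall i, bnd (g i)) ->
  bnd (fun x => \sum_(i <- l) c i * g i x) /\
  mean k (fun x => \sum_(i <- l) c i * g i x) = \sum_(i <- l) c i * mean k (g i).
Proof.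
have mU (V : set (arq_state zeta delta)) : measurable V by exact: measurable_arq_state.
move=> bg; elim: l => [|i l [bl IHl]].
  have -> : (fun x => \sum_(i <- [::]) c i * g i x) = fun=> 0.
    by apply/funext => x; rewrite big_nil.
  split; first exact: bnd_cst.
  rewrite big_nil; transitivity (0 * fine (distribution P (X k) setT)).
    exact: Rintegral_cst.
  by rewrite mul0r.
have -> : (fun x => \sum_(j <- i :: l) c j * g j x) =
    (fun x => c i * g i x + 1 * (fun x => \sum_(j <- l) c j * g j x) x).
  by apply/funext => x; rewrite big_cons mul1r.
split; first exact: (bndD (bndM (bnd_cst (c i)) (bg i)) (bndM (bnd_cst 1) bl)).
by rewrite big_cons -IHl /mean law_lin // mul1r.
Qed.

Lemma mean_indic k (B : nat * seq bool -> bool) :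
  mean k (fun x => (B x)%:R) = fine (P (X k @^-1` [set x | B (x.1, tval x.2)])).
Proof. by rewrite /mean law_indic // => V; exact: measurable_arq_state. Qed.

Lemma u_patterns k n m : (n <= S + m)%N -> u k n = \sum_(s <- patterns m)
  pattern_weight p s * mean k (fun x => (idle_count n (x.2 ++ s) < x.1.+1)%N%:R).
Proof.
move=> le_n; rewrite -(law_sum k (patterns m) (pattern_weight p) _).2; last first.
  by move=> s; exact: bnd_bool.
rewrite /u /mean /law; congr (Rintegral _ _ _); apply/funext => x.
by rewrite (@clear_patterns _ p n _ _ m) // size_tuple.
Qed.

(** * The late event as a finite union of cells with prescribed outcomes *)

Lemma idle_count_leS n s : (idle_count n s <= idle_count n.+1 s)%N.
Proof.
rewrite /idle_count; elim: s n => [|b s IHs] [|n] //=.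
by rewrite leq_add2l IHs.
Qed.

Lemma free_idle (x : int -> arq_state zeta delta) (e : int -> bool) k n m :
  (n <= S + m)%N ->
  free_slots x e k n = idle_count n ((x k).2 ++ mkseq (fun i => e (k + i%:Z)) m).
Proof.
rewrite /idle_count; elim: n => [|n IHn] le_n; first by rewrite take0.
rewrite /= IHn ?(ltnW le_n) // (take_nth false); last first.
  by rewrite size_cat size_tuple size_mkseq.
rewrite -cats1 count_cat /= addn0; congr (_ + ~~ _)%N.
rewrite nth_cat size_tuple /flag; case: ltnP => // le_Sn.
by rewrite nth_mkseq //; lia.
Qed.

(** [s] is meant to have length [t] and lists the outcomes before the first transmission; the
    default [true] of [nth] then encodes failure at the attempt slots [t + i * S]. *)
Definition late_cell k N t (s : seq bool) : set Omega :=
  pattern k [set x : arq_state zeta delta |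
      (idle_count t (x.2 ++ s) <= x.1 < idle_count t.+1 (x.2 ++ s))%N]
    true (iota 0 t ++ [seq (t + i * S)%N | i <- iota 0 ((N - t) %/ S)])
    (nth true s).

Definition long_wait_cell k n (s : seq bool) : set Omega :=
  pattern k [set x : arq_state zeta delta | (idle_count n (x.2 ++ s) <= x.1)%N] true (iota 0 n)
    (nth true s).

Lemma uniq_attempts N t :
  uniq (iota 0 t ++ [seq (t + i * S)%N | i <- iota 0 ((N - t) %/ S)]).
Proof.
rewrite cat_uniq iota_uniq /= map_inj_uniq ?iota_uniq ?andbT.
  by apply/hasPn => _ /mapP[i _ ->]; rewrite mem_iota; lia.
by move=> i j /addnI /eqP; rewrite eqn_pmul2r // => /eqP.
Qed.

Lemma prod_pattern (s : seq bool) :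
  \prod_(i <- iota 0 (size s)) weight p (nth true s i) = pattern_weight p s.
Proof. by rewrite /pattern_weight (big_nth true) /index_iota subn0. Qed.

Lemma long_wait_prob k n :
  \sum_(s <- patterns n) fine (P (long_wait_cell k n s)) = f * u k n.
Proof.
rewrite (@u_patterns k n n); last by lia.
rewrite mulr_sumr; apply: eq_big_seq => s; rewrite mem_patterns => /eqP sz.
rewrite (prob_pattern _ _ _ _ (iota_uniq 0 n)).2 -{2}sz prod_pattern.
set y := fine (P (X k @^-1` _)).
have -> : mean k (fun x => (idle_count n (x.2 ++ s) < x.1.+1)%N%:R) = y.
  exact: (mean_indic k (fun x => idle_count n (x.2 ++ s) < x.1.+1)%N).
by rewrite /weight; ring.
Qed.

(** The attempts take place in slots from [t] on, so their failures are independent of the wait. The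
    difference of the two values of [u] is the probability that the wait is exactly [t]. *)
Lemma late_prob k N t :
  \sum_(s <- patterns t) fine (P (late_cell k N t s)) =
  f * ((u k t - u k t.+1) * p ^+ ((N - t) %/ S)).
Proof.
have mU (V : set (arq_state zeta delta)) : measurable V by exact: measurable_arq_state.
rewrite (@u_patterns k t t); last by lia.
(* The state supplies at least one flag, so [t] outcomes settle [t.+1] slots. *)
rewrite (@u_patterns k t.+1 t); last by lia.
rewrite -sumrB mulr_suml mulr_sumr; apply: eq_big_seq => s.
rewrite mem_patterns => /eqP sz.
rewrite (prob_pattern _ _ _ _ (uniq_attempts N t)).2 big_cat -{3}sz prod_pattern /=.
have -> : \prod_(i <- [seq (t + i * S)%N | i <- iota 0 ((N - t) %/ S)])
    weight p (nth true s i) = p ^+ ((N - t) %/ S).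
  rewrite big_map (eq_bigr (fun=> p)) => [|i _].
    by rewrite big_const_seq count_predT size_iota iter_mulr_1.
  by rewrite nth_default // sz leq_addr.
rewrite -mulrBr.
have -> : mean k (fun x => (idle_count t (x.2 ++ s) < x.1.+1)%N%:R) -
    mean k (fun x => (idle_count t.+1 (x.2 ++ s) < x.1.+1)%N%:R) =
    mean k (fun x => (idle_count t (x.2 ++ s) <= x.1 < idle_count t.+1 (x.2 ++ s))%N%:R).
  rewrite -[X in X - _]mul1r -mulN1r -law_lin //; try exact: bnd_bool.
  rewrite /mean /law; congr (Rintegral _ _ _); apply/funext => x.
  have := idle_count_leS t (x.2 ++ s); rewrite !ltnS.
  move: (idle_count t _) (idle_count t.+1 _) => c d le_cd.
  rewrite mul1r mulN1r; case: (leqP d x.1) => [le_dx|lt_xd].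
    by rewrite (leq_trans le_cd le_dx) /= subrr.
  by rewrite subr0 andbT.
rewrite mean_indic; set y := fine (P (X k @^-1` _)).
by rewrite /weight; ring.
Qed.

Let late (T d : R) k : set Omega :=
  [set w | (d%:E < total_delay R (X ^~ w) (E ^~ w) k * T%:E)%E] `&` [set w | A k w].

Lemma late_cells (T d : R) k (D N : nat) :
  0 < T -> D%:R <= d / T < D.+1%:R -> N = (D + delta)%N ->
  late T d k = \big[setU/set0]_(t <- iota 0 N.+1)
      \big[setU/set0]_(s <- patterns t) late_cell k N t s `|`
    \big[setU/set0]_(s <- patterns N.+1) long_wait_cell k N.+1 s.
Proof.
move=> T0 /andP[DdT dTD] NE; apply/seteqP; split => w.
- move=> [lt_d Akw].
  have [[t le_tN [w_t fails]]|w_N] :=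
    delay_cover (fun j => arq_evolution arq j w) Akw T0 DdT NE lt_d.
  + left; rewrite -bigcup_seq; exists t.
      by have : t \in iota 0 N.+1 by rewrite mem_iota; lia.
    rewrite -bigcup_seq; exists (mkseq (fun i => E (k + i%:Z) w) t).
      by rewrite /= mem_patterns size_mkseq.
    split => //=.
      by move: w_t; rewrite !(@free_idle _ _ k _ t) //; lia.
    move=> i; rewrite mem_cat => /orP[|/mapP[j]].
      by rewrite mem_iota => /andP[_ lt_it]; rewrite nth_mkseq.
    rewrite mem_iota => /andP[_ lt_j] ->.
    by rewrite nth_default ?fails // size_mkseq leq_addr.
  + right; rewrite -bigcup_seq; exists (mkseq (fun i => E (k + i%:Z) w) N.+1).
      by have : mkseq (fun i => E (k + i%:Z) w) N.+1 \in patterns N.+1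
        by rewrite mem_patterns size_mkseq.
    split => //.
      by move: w_N; rewrite (@free_idle _ _ k _ N.+1); [exact | lia].
    by move=> i; rewrite mem_iota => /andP[_ lt_it]; rewrite nth_mkseq.
- have sE n s : size s = n -> (forall i, (i < n)%N -> E (k + i%:Z) w = nth true s i) ->
      s = mkseq (fun i => E (k + i%:Z) w) n.
    move=> sz es; apply: (@eq_from_nth _ true); first by rewrite size_mkseq.
    by move=> i; rewrite sz => lt_in; rewrite nth_mkseq // es.
  case.
  + rewrite -bigcup_seq => -[t t_in]; move: (t_in : t \in iota 0 N.+1); rewrite mem_iota add0n.
    move=> /andP[_ le_tN].
    rewrite -bigcup_seq => -[s]; rewrite /= mem_patterns => /eqP sz [/= w_t Akw es].
    have {}sE : s = mkseq (fun i => E (k + i%:Z) w) t.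
      by apply: sE => // i lt_it; apply: es; rewrite mem_cat mem_iota lt_it.
    split => //; apply: (delay_cover_conv (fun j => arq_evolution arq j w) Akw T0 dTD NE).
    left; exists t => //; split.
      by rewrite !(@free_idle _ _ k _ t) -?sE //; lia.
    move=> i lt_i; rewrite es ?nth_default ?sz ?leq_addr //.
    by rewrite mem_cat; apply/orP; right; apply/mapP; exists i; rewrite ?mem_iota.
  + rewrite -bigcup_seq => -[s s_in [w_N Akw es]].
    move: (s_in : s \in patterns N.+1); rewrite mem_patterns => /eqP sz.
    have {}sE : s = mkseq (fun i => E (k + i%:Z) w) N.+1.
      by apply: sE => // i lt_it; apply: es; rewrite mem_iota.
    split => //; apply: (delay_cover_conv (fun j => arq_evolution arq j w) Akw T0 dTD NE).
    by right; rewrite (@free_idle _ _ k _ N.+1) -?sE //; lia.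
Qed.

(** A union bound over the cells, regrouped by the number of failures with [delay_sum]. The factor
    [f] is the probability of the arrival, which is part of [late]. *)
Lemma late_bound (T d : R) k (D N : nat) :
  0 < T -> D%:R <= d / T < D.+1%:R -> N = (D + delta)%N ->
  fine (P (late T d k)) <=
    f * (p ^+ (N %/ S) +
      \sum_(i < N %/ S) p ^+ i * (1 - p) * u k (N.+1 - i.+1 * S)%N).
Proof.
move=> T0 DdT NE; rewrite (late_cells k T0 DdT NE).
have mlate t : measurable (\big[setU/set0]_(s <- patterns t) late_cell k N t s).
  apply: measurable_bigsetU_seq => s _.
  exact: (prob_pattern _ _ _ _ (uniq_attempts N t)).1.
have mwait s : measurable (long_wait_cell k N.+1 s).
  exact: (prob_pattern _ _ _ _ (iota_uniq 0 N.+1)).1.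
have u0 : u k 0 = 1.
  transitivity (mean k (fun=> 1)); last first.
    by apply: law_cst => V; exact: measurable_arq_state.
  by [].
rewrite -(delay_sum p N (isT : (0 < S)%N) u0) mulrDr -long_wait_prob mulr_sumr.
apply: (@le_trans _ _ (fine (P (\big[setU/set0]_(t <- iota 0 N.+1)
      \big[setU/set0]_(s <- patterns t) late_cell k N t s)) +
    fine (P (\big[setU/set0]_(s <- patterns N.+1) long_wait_cell k N.+1 s)))).
  have m1 : measurable (\big[setU/set0]_(t <- iota 0 N.+1)
      \big[setU/set0]_(s <- patterns t) late_cell k N t s).
    by apply: measurable_bigsetU_seq => t _; exact: mlate.
  have m2 : measurable (\big[setU/set0]_(s <- patterns N.+1) long_wait_cell k N.+1 s).
    by apply: measurable_bigsetU_seq => s _; exact: mwait.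
  rewrite -fineD ?fin_num_measure // fine_le ?fin_numD ?fin_num_measure //.
    exact: measurableU.
  by apply: measureU2.
apply: lerD; last by apply: union_bound => s _; exact: mwait.
apply: (@le_trans _ _ (\sum_(t <- iota 0 N.+1)
    fine (P (\big[setU/set0]_(s <- patterns t) late_cell k N t s)))).
  by apply: union_bound => t _; exact: mlate.
rewrite -[iota 0 N.+1]/(index_iota 0 N.+1) big_mkord; apply: ler_sum => t _.
rewrite -late_prob; apply: union_bound => s _.
exact: (prob_pattern _ _ _ _ (uniq_attempts N t)).1.
Qed.

End SteadyState.

Theorem theorem1 (R : realType) (disp : measure_display)
    (Omega : measurableType disp) (P : probability Omega R)
    (f p : R) (zeta delta : nat) (T d : R)
    (A E : int -> {RV P >-> bool})
    (X : int -> {RV P >-> arq_state zeta delta}) (k : int)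
    (f_gt0 : 0 < f) (f_lt1 : f < 1) (p_gt0 : 0 < p) (p_lt1 : p < 1)
    (fp_lt1 : f + p < 1) (T_gt0 : 0 < T) (d_ge0 : 0 <= d)
    (denom_neq0 : f + (p / (1 - f)) ^+ (delta + zeta) - 1 != 0)
    (arq : steady_arq f p A E X) :
  let kd : int := Num.floor ((d / T + delta%:R) / (delta + zeta + 1)%:R) in
  let r : R := p / (1 - f) in
  is_true (cond_prob P
    [set w | (d%:E < total_delay R (X ^~ w) (E ^~ w) k * T%:E)%E]
    [set w | A k w]
  <= p ^ kd
     + f * r ^ (Num.floor (d / T) + delta%:Z)
         * (1 - p ^ kd * r ^ (- kd * (1 + delta + zeta)%:Z))
       / (f + r ^+ (delta + zeta) - 1)).
Proof.
move=> kd r; rewrite /cond_prob (arq_arrival arq) /= ler_pdivrMr // [leRHS]mulrC.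
have f1 : 0 < 1 - f by rewrite subr_gt0.
have r0 : r != 0 by rewrite mulf_neq0 ?invr_eq0 ?gt_eqF.
have dT0 : 0 <= d / T by rewrite divr_ge0 // ltW.
have [D DE] : exists D : nat, Num.floor (d / T) = D.
  by exists `|Num.floor (d / T)|%N; rewrite gez0_abs // floor_ge0.
have DdT : D%:R <= d / T < D.+1%:R.
  have := floor_itv (d / T); rewrite DE.
  by rewrite -[D%:Z + 1]/(D + 1)%N%:Z addn1.
set N := (D + delta)%N; set K := (N %/ (1 + zeta + delta))%N.
(* Rounding [d / T] down first does not change the floor of a quotient by a positive integer. *)
have kdE : kd = K.
  have /andP[DdT1 DdT2] := DdT.
  rewrite /kd; apply: floor_def; rewrite -[K%:Z + 1]/(K + 1)%N%:Z !addn1 -!pmulrn.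
  have SE : ((delta + zeta).+1 = 1 + zeta + delta)%N by rewrite addnC.
  rewrite SE ler_pdivlMr ?ltr_pdivrMr ?ltr0n // -!natrM; apply/andP; split.
    apply: (@le_trans _ _ N%:R); first by rewrite ler_nat leq_trunc_div.
    by rewrite natrD lerD2r.
  apply: (@lt_le_trans _ _ N.+1%:R).
    by rewrite -addSn natrD ltrD2r.
  by rewrite ler_nat ltn_ceil.
have le_KN : (K * (zeta + delta).+1 <= N)%N by rewrite /K leq_trunc_div.
apply: le_trans (late_bound f_gt0 f_lt1 p_gt0 p_lt1 fp_lt1 arq k T_gt0 DdT (erefl N)) _.
rewrite ler_pM2l // -/K kdE DE lerD2l.
(* For i < K the exponent is positive, as [wait_tail] requires. *)
apply: (@le_trans _ _ (\sum_(i < K) p ^+ i * (1 - p) *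
    (f / (1 - p) * r ^+ (N.+1 - i.+1 * (zeta + delta).+1)))).
  apply: ler_sum => i _; rewrite ler_wpM2l //.
    by rewrite mulr_ge0 ?exprn_ge0 ?subr_ge0 ?ltW.
  apply: (wait_tail f_gt0 f_lt1 p_gt0 p_lt1 fp_lt1 arq).
  rewrite subn_gt0 ltnS (leq_trans _ le_KN) //.
  by rewrite leq_mul2r ltn_ord orbT.
rewrite le_eqVlt; apply/orP; left; apply/eqP.
have p1 : 1 - p != 0 by rewrite subr_eq0 gt_eqF.
have -> : \sum_(i < K) p ^+ i * (1 - p) *
    (f / (1 - p) * r ^+ (N.+1 - i.+1 * (zeta + delta).+1)) =
    f * \sum_(i < K) p ^+ i * r ^+ (N.+1 - i.+1 * (zeta + delta).+1).
  by rewrite mulr_sumr; apply: eq_bigr => i _; field.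
(* Multiplying by the denominator brings the sum into its telescoping form. *)
apply: (mulIf denom_neq0); rewrite divfK // -/r -!mulrA [(delta + zeta)%N]addnC.
rewrite (geometric_delay_sum r0 _ le_KN); last by rewrite /r; field; rewrite gt_eqF.
have e1 : r ^ (D%:Z + delta%:Z) = r ^+ N by [].
have e2 : r ^ (- K%:Z * (1 + delta + zeta)%N%:Z) = (r ^+ (K * (zeta + delta).+1))^-1.
  rewrite mulNr -invr_expz -PoszM -exprnP.
  by rewrite [(zeta + delta)%N]addnC.
have e3 : r ^+ N = r ^+ (N - K * (zeta + delta).+1) * r ^+ (K * (zeta + delta).+1).
  by rewrite -exprD subnK.
have y0 : r ^+ (K * (zeta + delta).+1) != 0 by rewrite expf_neq0.
rewrite e1 e2 -exprnP e3.
move: (r ^+ (N - _)) (r ^+ (K * _)) (p ^+ K) y0 => x y q y0.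
by field.
Qed.
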